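(* Let $\mathbb{F}$ be algebraically closed (of characteristic not $2$ or $3$) and let $$\Gamma_{\mathrm{Eisenstein}}=\big\{(A,B,D,C)\in (L^2\times L^2\times L^2\times L^3)\setminus\{0\} : 27DA^2+4B^3=-2^4 3^6C^2\big\}.$$ 1. The map $\zeta_s:\mathcal{A}^c_{\mathrm{st}}/SL(V)\to\Gamma_{\mathrm{Eisenstein}}$ given by $\zeta_s(m)=(\tilde p_3(m),\tilde p_2(m),\mathrm{Disc}(Q_m),\mathrm{Inv}_m)$ is a bijection. 2. Let $\mathbb{F}^*$ act on $\Gamma_{\mathrm{Eisenstein}}$ by $$\lambda\cdot(A,B,D,C)=\Big(\frac1{\lambda^2}A,\frac1{\lambda^2}B,\frac1{\lambda^2}D,\frac1{\lambda^3}C\Big),\qquad\lambda\in\mathbb{F}^*,$$ and denote by $\widetilde{\mathbb{P}}(\Gamma_{\mathrm{Eisenstein}})$ the quotient of $\Gamma_{\mathrm{Eisenstein}}$ by this action. Then $\zeta_s$ induces a bijective map $\zeta_g:\mathcal{A}^c_{\mathrm{st}}/GL(V)\to\widetilde{\mathbb{P}}(\Gamma_{\mathrm{Eisenstein}})$.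
   Context: $V$ is a two-dimensional $\mathbb{F}$-vector space. $L=\Lambda^2(V^* )$ is the one-dimensional space of antisymmetric bilinear forms on $V$, $L^r$ its $r$-th tensor power, with $L^r\otimes L^s=L^{r+s}$. $\mathcal{A}^c$ is the set of symmetric bilinear maps $m:V\times V\to V$. $GL(V)$, and hence $SL(V)$, acts on $\mathcal{A}^c$ by $(g\cdot m)(v,w)=g\big(m(g^{-1}v,g^{-1}w)\big)$. The set of stable algebras $\mathcal{A}^c_{\mathrm{st}}$ is the set of $m\in\mathcal{A}^c$ for which there exists an $SL(V)$-invariant homogeneous polynomial $F$ of positive degree on $\mathcal{A}^c$ with $F(m)\ne0$. Let $(e_1,e_2)$ be a basis of $V$ with dual basis $(\epsilon_1,\epsilon_2)$, put $\omega=\epsilon_1\wedge\epsilon_2$, and write $m(e_1,e_1)=ae_1+be_2$, $m(e_2,e_2)=ce_1+de_2$, $m(e_1,e_2)=ee_1+fe_2$. The fundamental cubic is $Q_m(v)=m(v,v)\wedge v$; thus $Q_m(xe_1+ye_2)=q(x,y)\,e_1\wedge e_2$ with $q(x,y)=-bx^3+(a-2f)x^2y+(2e-d)xy^2+cy^3$. Writing $q=A_0x^3+B_0x^2y+C_0xy^2+D_0y^3$, $\mathrm{Disc}(Q_m)=(18A_0B_0C_0D_0+B_0^2C_0^2-4A_0C_0^3-4B_0^3D_0-27A_0^2D_0^2)\,\omega^2\in L^2$. Put $\mu(x,y)=q_{xx}q_{yy}-q_{xy}^2$, $G(x,y)=q_x\mu_y-q_y\mu_x$, $\tau=(d+e,-(a+f))$.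 Define $\tilde p_3(m)=-8q(\tau)\omega^2\in L^2$, $\tilde p_2(m)=\mu(\tau)\omega^2\in L^2$, $\mathrm{Inv}_m=\frac1{54}G(\tau)\omega^3\in L^3$. These do not depend on the basis and are invariant under $SL(V)$. The map $\zeta_s$ is written on representatives of $SL(V)$-classes. *)

(* Defs.v *)
From mathcomp Require Import all_boot all_order all_algebra.
From mathcomp Require Import sesquilinear.
From mathcomp Require Import boolp classical_sets functions.
From mathcomp Require Import mpoly ring.

Set Implicit Arguments.
Unset Strict Implicit.
Unset Printing Implicit Defensive.

Import GRing.Theory.
Local Open Scope classical_set_scope.
Local Open Scope ring_scope.

(* For a group G (given as a set of elements) acting on X, the quotient Y / G
   is the set of orbits of the points of Y. *)
Section Quotients.
Context {T X : Type}.

Definition act_orbit (G : set T) (act : T -> X -> X) (x : X) : set X :=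
  [set act g x | g in G].

Definition act_quotient (G : set T) (act : T -> X -> X) (Y : set X) :
    set (set X) :=
  [set act_orbit G act x | x in Y].

End Quotients.

(* L = Lambda^2(V^* ) and its tensor powers.  The r-th tensor power of L is
   realized as the space of functions of r pairs of vectors that are an
   antisymmetric bilinear form in each pair; the tensor product
   L^r (x) L^s = L^(r + s) is then the product on separate variables. *)
Section Forms.
Variables (F : fieldType) (V : vectType F).

Definition antisym_form (w : V -> V -> F^o) : Prop :=
  bilinear_for *:%R *:%R w /\ forall v v', w v v' = - w v' v.

Definition Lform (r : nat) : Type := ('I_r -> V * V) -> F^o.

Definition Lpow (r : nat) : set (Lform r) :=
  [set t | forall (x : 'I_r -> V * V) (i : 'I_r),
     antisym_form (fun v v' => t (dfwith x (i := i) (v, v')))].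

Definition tens (r s : nat) (t : Lform r) (u : Lform s) : Lform (r + s) :=
  fun x => t (fun i => x (lshift s i)) * u (fun j => x (rshift r j)).

Definition tpow (w : V -> V -> F^o) (r : nat) : Lform r :=
  fun x => \prod_(i < r) w (x i).1 (x i).2.

Definition quadruple : Type := (Lform 2 * Lform 2 * Lform 2 * Lform 3)%type.

Definition Gamma_Eisenstein : set quadruple :=
  [set p : quadruple | let: (A, B, D, C) := p in
    [/\ [/\ Lpow A, Lpow B, Lpow D & Lpow C],
        (A, B, D, C) <> 0 &
        27 *: tens D (tens A A) + 4 *: tens B (tens B B)
          = - (2 ^+ 4 * 3 ^+ 6) *: tens C C :> Lform 6 ]].

Definition Fstar : set F := [set l | l != 0].

Definition scale_quadruple (l : F) (p : quadruple) : quadruple :=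
  let: (A, B, D, C) := p in
  (l ^- 2 *: A, l ^- 2 *: B, l ^- 2 *: D, l ^- 3 *: C).

End Forms.

Arguments Lform {F} V r.
Arguments quadruple {F} V.
Arguments Lpow {F V} r _.
Arguments tpow {F V} w r _.
Arguments Gamma_Eisenstein {F} V _.
Arguments scale_quadruple {F V} l p.
Arguments Fstar F _ : clear implicits.

Section Algebras.
Variables (F : fieldType) (V : vectType F).

Definition Ac : set (V -> V -> V) :=
  [set m | bilinear_for *:%R *:%R m /\ forall v w, m v w = m w v].

Definition GL : set 'End(V) := [set g | lker g == 0%VS].

Definition act (g : 'End(V)) (m : V -> V -> V) : V -> V -> V :=
  fun v w => g (m ((g^-1)%VF v) ((g^-1)%VF w)).

Definition SL : set 'End(V) :=
  [set g | GL g /\ \det (passmx.mxof (vbasis {:V}) (vbasis {:V}) g) = 1].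

(* The basis (e_1, e_2) = (e`_0, e`_1) of V used in all that follows. *)
Variable e : 2.-tuple V.

Section Invariants.
Variable m : V -> V -> V.

Let e1 := e`_0.
Let e2 := e`_1.
Let eps1 := coord e 0.
Let eps2 := coord e 1.

Definition sc_a : F := eps1 (m e1 e1).
Definition sc_b : F := eps2 (m e1 e1).
Definition sc_c : F := eps1 (m e2 e2).
Definition sc_d : F := eps2 (m e2 e2).
Definition sc_e : F := eps1 (m e1 e2).
Definition sc_f : F := eps2 (m e1 e2).

Definition struct_consts : 'I_6 -> F :=
  tnth [tuple sc_a; sc_b; sc_c; sc_d; sc_e; sc_f].

Definition omega (v w : V) : F^o := eps1 v * eps2 w - eps1 w * eps2 v.

Definition cub0 : F := - sc_b.
Definition cub1 : F := sc_a - 2 * sc_f.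
Definition cub2 : F := 2 * sc_e - sc_d.
Definition cub3 : F := sc_c.

Definition cubic : {mpoly F[2]} :=
  cub0 *: 'X_0 ^+ 3 + cub1 *: ('X_0 ^+ 2 * 'X_1)
  + cub2 *: ('X_0 * 'X_1 ^+ 2) + cub3 *: 'X_1 ^+ 3.

Definition hess : {mpoly F[2]} :=
  cubic^`M(0)^`M(0) * cubic^`M(1)^`M(1) - cubic^`M(0)^`M(1) ^+ 2.

Definition jac : {mpoly F[2]} :=
  cubic^`M(0) * hess^`M(1) - cubic^`M(1) * hess^`M(0).

Definition tau : 'I_2 -> F := tnth [tuple sc_d + sc_e; - (sc_a + sc_f)].

Definition Disc : Lform V 2 :=
  (18 * cub0 * cub1 * cub2 * cub3 + cub1 ^+ 2 * cub2 ^+ 2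
   - 4 * cub0 * cub2 ^+ 3 - 4 * cub1 ^+ 3 * cub3
   - 27 * cub0 ^+ 2 * cub3 ^+ 2) *: tpow omega 2.

Definition p3 : Lform V 2 := (- 8 * cubic.@[tau]) *: tpow omega 2.

Definition p2 : Lform V 2 := hess.@[tau] *: tpow omega 2.

Definition Inv : Lform V 3 := (54^-1 * jac.@[tau]) *: tpow omega 3.

Definition zeta : quadruple V := (p3, p2, Disc, Inv).

End Invariants.

(* The coefficient of e_1 /\ e_2 in u /\ v is omega u v, so that the form
   [cubic m] represents the fundamental cubic Q_m(v) = m(v, v) /\ v. *)
Lemma fundamental_cubicE (m : V -> V -> V) (x y : F) :
    basis_of fullv e -> Ac m ->
    let v := x *: e`_0 + y *: e`_1 in
  omega (m v v) v = (cubic m).@[tnth [tuple x; y]].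
Proof.
move=> eB [[bl br] ms] v.
have ml u1 u2 w c : m (c *: u1 + u2) w = c *: m u1 w + m u2 w by exact: bl.
have mr u1 u2 w c : m w (c *: u1 + u2) = c *: m w u1 + m w u2 by exact: br.
have ml0 w c u : m (c *: u) w = c *: m u w.
  have m0 : m 0 w = 0.
    by have := ml 0 0 w (-1); rewrite scaler0 addr0 scaleN1r addNr.
  by have := ml u 0 w c; rewrite !addr0 m0 addr0.
have mr0 w c u : m w (c *: u) = c *: m w u by rewrite ms ml0 ms.
have coordE (i j : 'I_2) : coord e i e`_j = (i == j)%:R.
  by rewrite coord_free ?(basis_free eB) // eq_sym.
rewrite /v /omega !(ml, mr, ml0, mr0) [m e`_1 e`_0]ms.
have c00 : coord e 0 e`_0 = 1 := coordE 0 0.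
have c01 : coord e 0 e`_1 = 0 := coordE 0 1.
have c10 : coord e 1 e`_0 = 0 := coordE 1 0.
have c11 : coord e 1 e`_1 = 1 := coordE 1 1.
rewrite !(linearD, linearZ) /= c00 c01 c10 c11.
rewrite /cubic !(mevalD, mevalZ, mevalM, rmorphXn, mevalXU) /=.
rewrite !(tnth_nth 0) /= /cub0 /cub1 /cub2 /cub3.
rewrite /sc_a /sc_b /sc_c /sc_d /sc_e /sc_f /=.
ring.
Qed.

(* A homogeneous polynomial of degree d on Ac is a homogeneous polynomial of
   degree d in the structure constants, i.e., in linear coordinates on Ac. *)
Definition is_homog_poly (d : nat) (f : (V -> V -> V) -> F) : Prop :=
  exists2 P : {mpoly F[6]}, P \is d.-homog &
    forall m, Ac m -> f m = P.@[struct_consts m].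

Definition SL_invariant (f : (V -> V -> V) -> F) : Prop :=
  forall g m, SL g -> Ac m -> f (act g m) = f m.

Definition Ac_st : set (V -> V -> V) :=
  [set m | Ac m /\ exists d f,
     [/\ (0 < d)%N, is_homog_poly d f, SL_invariant f & f m != 0]].

End Algebras.

Arguments act {F V} g m v w.
Arguments Ac {F} V _.
Arguments GL {F} V _.
Arguments SL {F} V _.
Arguments Ac_st {F V} e _.

(* Main.v *)
From HB Require Import structures.
Require Import Defs.
From mathcomp Require Import all_boot all_order all_algebra.
From mathcomp Require Import sesquilinear.
From mathcomp Require Import boolp classical_sets functions.
From mathcomp Require Import mpoly ring.

Set Implicit Arguments.
Unset Strict Implicit.
Unset Printing Implicit Defensive.

Import GRing.Theory.
Local Open Scope classical_set_scope.
Local Open Scope ring_scope.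

(** When 3 is invertible, a symmetric bilinear multiplication [m] on the plane
    amounts to a pair (q, tau): a binary cubic q, the fundamental cubic, and a
    vector tau, which represents the trace of multiplication through omega
    ([cubvec_of], [algebra_ofK], [cubvec_of_algebra_of]).  A linear map g
    carries (q, tau) to (q o g^-1, g tau) up to powers of det g
    ([cubvec_of_act]), so the orbits of SL(V) on algebras are the orbits of
    SL(2) on pairs.  The components of zeta are, up to constants that are
    invertible away from characteristics 2 and 3, the classical invariants of a
    pair: a = q(tau), the Hessian h and the Jacobian covariant j at tau, and the
    discriminant d.  Eisenstein's relation h^3 + j^2 + 432 d a^2 = 0
    ([syzygy]) is the equation of the target.

    Over an algebraically closed field the four invariants reconstruct the
    pair.  If tau is nonzero, move it to (1, 0); shears keep it fixed.  If a is
    nonzero, a shear removes the coefficient of x^2 y, and a, h, j give the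
    remaining coefficients.  If a = 0 but the coefficient B of x^2 y is
    nonzero, a shear removes the coefficient of x y^2, and h, j, d give the
    rest.  If tau = 0, move a root of q to (1, 0) and normalize the cubic to
    x^2 y + D y^3, where d = - 4 D.  This defines a section [normal_form] of
    the invariants: each point of Eisenstein's hypersurface is the tuple of
    invariants of its normal form ([invs_normal_form]), whence surjectivity;
    and every pair is equivalent to its normal form, except those equivalent to
    a pair with tau = (x, 0) and q = y^2 (C x + D y) ([sl_equiv_normal_form]),
    whence injectivity.

    The exceptional pairs are exactly the unstable ones.  On such a pair the
    one-parameter group diag(t, 1/t) has only positive weights, so a
    homogeneous invariant of positive degree vanishes there
    ([null_unstable]); conversely the four invariants are themselves
    homogeneous of positive degree, so an algebra where one of them is nonzero
    is stable ([invs_stable]).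

    For GL(V) it remains to observe that zeta (g m) is zeta m scaled by det g
    ([zeta_act]), and that det g takes every nonzero value: two stable algebras
    whose images are proportional become SL(V)-equivalent after applying a
    suitable g to one of them. *)

(** * Covariants of a binary cubic and a vector *)

Lemma natr23_neq0 (F : fieldType) (k l : nat) :
  2 != 0 :> F -> 3 != 0 :> F -> (2 ^ k * 3 ^ l)%:R != 0 :> F.
Proof. by move=> n2 n3; rewrite natrM !natrX mulf_neq0 // expf_neq0. Qed.

(** The cubic A x^3 + B x^2 y + C x y^2 + D y^3 and the vector (vx, vy).  The
    coefficients live in an arbitrary type so that the same formulas can be
    applied over polynomial rings. *)
Record cubvec (R : Type) :=
  Cubvec { cA : R; cB : R; cC : R; cD : R; vx : R; vy : R }.

(* The side conditions of [field] come as one boolean conjunction, in which a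
   numeral may carry a sign. *)
Ltac field_nz :=
  field; rewrite ?oppr_eq0; repeat (apply/andP; split); by [].

Section Covariants.
Context {R : comNzRingType}.
Implicit Type X : cubvec R.

(** The determinant of second derivatives of the cubic is
    4 (hessA x^2 + hessB x y + hessC y^2). *)
Definition hessA X := 3 * cA X * cC X - cB X ^+ 2.
Definition hessB X := 9 * cA X * cD X - cB X * cC X.
Definition hessC X := 3 * cB X * cD X - cC X ^+ 2.

(** The suffixes x and y stand for the partial derivatives of the cubic and of
    its Hessian, evaluated at the vector. *)
Definition cubx X :=
  3 * cA X * vx X ^+ 2 + 2 * cB X * vx X * vy X + cC X * vy X ^+ 2.
Definition cuby X :=
  cB X * vx X ^+ 2 + 2 * cC X * vx X * vy X + 3 * cD X * vy X ^+ 2.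
Definition hessx X := 4 * (2 * hessA X * vx X + hessB X * vy X).
Definition hessy X := 4 * (hessB X * vx X + 2 * hessC X * vy X).

Definition cub_val X :=
  cA X * vx X ^+ 3 + cB X * vx X ^+ 2 * vy X
  + cC X * vx X * vy X ^+ 2 + cD X * vy X ^+ 3.
Definition hess_val X :=
  4 * (hessA X * vx X ^+ 2 + hessB X * vx X * vy X + hessC X * vy X ^+ 2).
Definition disc X :=
  18 * cA X * cB X * cC X * cD X + cB X ^+ 2 * cC X ^+ 2
  - 4 * cA X * cC X ^+ 3 - 4 * cB X ^+ 3 * cD X - 27 * cA X ^+ 2 * cD X ^+ 2.
Definition jac_val X := cubx X * hessy X - cuby X * hessx X.

Definition invs X := (cub_val X, hess_val X, disc X, jac_val X).

(** The pair (q o adj g, g v) for g = (p q; r s).  With the adjugate in place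
    of the inverse the formulas are polynomial, and agree with the action of g
    when det g = 1. *)
Definition sl_act (p q r s : R) X : cubvec R :=
  let: Cubvec A B C D x y := X in
  Cubvec (A * s ^+ 3 - B * s ^+ 2 * r + C * s * r ^+ 2 - D * r ^+ 3)
    (- 3 * A * s ^+ 2 * q + B * (s ^+ 2 * p + 2 * s * q * r)
     - C * (2 * p * r * s + q * r ^+ 2) + 3 * D * r ^+ 2 * p)
    (3 * A * s * q ^+ 2 - B * (r * q ^+ 2 + 2 * s * q * p)
     + C * (s * p ^+ 2 + 2 * q * r * p) - 3 * D * r * p ^+ 2)
    (- A * q ^+ 3 + B * q ^+ 2 * p - C * q * p ^+ 2 + D * p ^+ 3)
    (p * x + q * y) (r * x + s * y).

End Covariants.

Arguments invs : simpl never.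

Ltac unfold_invs :=
  rewrite /invs /cub_val /hess_val /disc /jac_val /cubx /cuby /hessx /hessy
          /hessA /hessB /hessC /=.

Section Identities.
Context {R : comNzRingType}.
Implicit Types (X : cubvec R) (A B C D x : R).

(** Eisenstein's relation between the covariants of a binary cubic, read at one
    vector. *)
Lemma syzygy X :
  hess_val X ^+ 3 + jac_val X ^+ 2 + 432 * disc X * cub_val X ^+ 2 = 0.
Proof. by unfold_invs; case: X => A B C D x y /=; ring. Qed.

Lemma cub_val_sl_act p q r s X :
  cub_val (sl_act p q r s X) = (p * s - q * r) ^+ 3 * cub_val X.
Proof. by unfold_invs; case: X => A B C D x y /=; ring. Qed.

Lemma hess_val_sl_act p q r s X :
  hess_val (sl_act p q r s X) = (p * s - q * r) ^+ 4 * hess_val X.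
Proof. by unfold_invs; case: X => A B C D x y /=; ring. Qed.

Lemma disc_sl_act p q r s X :
  disc (sl_act p q r s X) = (p * s - q * r) ^+ 6 * disc X.
Proof. by unfold_invs; case: X => A B C D x y /=; ring. Qed.

Lemma jac_val_sl_act p q r s X :
  jac_val (sl_act p q r s X) = (p * s - q * r) ^+ 6 * jac_val X.
Proof. by unfold_invs; case: X => A B C D x y /=; ring. Qed.

(** Because adj (g h) = adj h * adj g. *)
Lemma sl_act_comp p q r s p' q' r' s' X :
  sl_act p q r s (sl_act p' q' r' s' X) =
  sl_act (p * p' + q * r') (p * q' + q * s') (r * p' + s * r') (r * q' + s * s') X.
Proof. by case: X => A B C D x y /=; congr Cubvec; ring. Qed.

(** If A is nonzero, the first, second and fourth invariants recover A, C and D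
    one after the other, away from characteristics 2 and 3. *)
Lemma invs_depressed A C D :
  invs (Cubvec A 0 C D 1 0)
    = (A, 12 * A * C, - 4 * A * C ^+ 3 - 27 * A ^+ 2 * D ^+ 2, 108 * A ^+ 2 * D).
Proof. by unfold_invs; congr (_, _, _, _); ring. Qed.

(** When the vector is a root of the cubic, B is recovered as the ratio
    - j / (2 h), and then D from the discriminant. *)
Lemma invs_simple_root B D :
  invs (Cubvec 0 B 0 D 1 0)
    = (0, - 4 * B ^+ 2, - 4 * B ^+ 3 * D, 8 * B ^+ 3).
Proof. by unfold_invs; congr (_, _, _, _); ring. Qed.

Lemma invs_no_vector D :
  invs (Cubvec 0 1 0 D 0 0) = (0, 0, - 4 * D, 0).
Proof. by unfold_invs; congr (_, _, _, _); ring. Qed.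

Lemma invs_null C D x : invs (Cubvec 0 0 C D x 0) = (0, 0, 0, 0).
Proof. by unfold_invs; congr (_, _, _, _); ring. Qed.

End Identities.

Definition map_cubvec (R S : Type) (phi : R -> S) (X : cubvec R) : cubvec S :=
  let: Cubvec A B C D x y := X in
  Cubvec (phi A) (phi B) (phi C) (phi D) (phi x) (phi y).

(** The invariants are integral polynomials in the coordinates.  This is used
    with evaluation morphisms, once to compute zeta from polynomials in two
    variables, once to present the invariants as polynomials in the structure
    constants. *)
Lemma invs_map (R S : comNzRingType) (phi : {rmorphism R -> S}) X :
  invs (map_cubvec phi X) =
  (phi (cub_val X), phi (hess_val X), phi (disc X), phi (jac_val X)).
Proof.
case: X => A B C D x y; unfold_invs.
by rewrite !(rmorph_nat, rmorphXn, rmorphN, rmorphM, rmorphD).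
Qed.

(** * Normal forms under SL(2) *)

Section NormalForms.
Variable F : closedFieldType.
Hypotheses (two_neq0 : 2 != 0 :> F) (three_neq0 : 3 != 0 :> F).
Let natr_neq0 k l := natr23_neq0 k l two_neq0 three_neq0.
Implicit Types (X Y Z : cubvec F) (t : F * F * F * F).

Definition sl_equiv X Y :=
  exists p q r s, p * s - q * r = 1 /\ Y = sl_act p q r s X.

Lemma sl_equiv_trans Y X Z : sl_equiv X Y -> sl_equiv Y Z -> sl_equiv X Z.
Proof.
move=> [p' [q' [r' [s' [d' ->]]]]] [p [q [r [s [d ->]]]]].
rewrite sl_act_comp; do 4!eexists; split; last by [].
by rewrite -[RHS]mulr1 -{1}d -d'; ring.
Qed.

Lemma invs_sl_equiv X Y : sl_equiv X Y -> invs Y = invs X.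
Proof.
move=> [p [q [r [s [d ->]]]]]; rewrite /invs.
rewrite cub_val_sl_act hess_val_sl_act disc_sl_act jac_val_sl_act.
by rewrite d !expr1n !mul1r.
Qed.

(** A section of the invariants over the hypersurface of Eisenstein's relation.
    In the second case the coefficient B of x^2 y is - j / (2 h), and
    2 d h^3 / j^3 is - d / (4 B^3). *)
Definition normal_form t : cubvec F :=
  let: (a, h, d, j) := t in
  if a != 0 then Cubvec a 0 (h / (12 * a)) (j / (108 * a ^+ 2)) 1 0
  else if h != 0 then
    Cubvec 0 (- j / (2 * h)) 0 (2 * d * h ^+ 3 / j ^+ 3) 1 0
  else Cubvec 0 1 0 (- d / 4) 0 0.

Arguments normal_form : simpl never.

(** The components used in [normal_form] come back by construction; the
    relation gives the remaining one: d in the first case, h and j separately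
    from their ratio in the second, and j = 0 in the third. *)
Lemma invs_normal_form a h d j :
  h ^+ 3 + j ^+ 2 + 432 * d * a ^+ 2 = 0 ->
  invs (normal_form (a, h, d, j)) = (a, h, d, j).
Proof.
have n4 : 4 != 0 :> F := natr_neq0 2 0.
have n12 : 12 != 0 :> F := natr_neq0 2 1.
have n108 : 108 != 0 :> F := natr_neq0 2 3.
have n432 : 432 != 0 :> F := natr_neq0 4 3.
rewrite /normal_form => syz; have [a0|an0] := eqVneq a 0; last first.
  rewrite /= invs_depressed.
  have -> : d = - (h ^+ 3 + j ^+ 2) / (432 * a ^+ 2).
    apply: (mulfI (mulf_neq0 n432 (expf_neq0 2 an0))).
    rewrite [RHS]mulrC divfK ?mulf_neq0 ?expf_neq0 //.
    by apply/eqP; rewrite -addr_eq0 -syz; apply/eqP; ring.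
  by congr (_, _, _, _); field_nz.
move: syz; rewrite a0 expr0n mulr0 addr0 /= => syz.
have [h0|hn0] := eqVneq h 0.
  move: syz; rewrite h0 expr0n add0r => /eqP; rewrite expf_eq0 /= => /eqP ->.
  by rewrite invs_no_vector; congr (_, _, _, _); field_nz.
have jh : j ^+ 2 = - h ^+ 3 by apply/eqP; rewrite -addr_eq0 addrC syz.
have jn0 : j != 0.
  apply: contraNneq hn0 => j0.
  have : h ^+ 3 == 0 by rewrite -oppr_eq0 -jh j0 expr0n.
  by rewrite expf_eq0.
rewrite /= invs_simple_root.
congr (_, _, _, _).
- transitivity (- j ^+ 2 / h ^+ 2); first by field_nz.
  by rewrite jh; field_nz.
- by field_nz.
- transitivity (- j ^+ 2 * j / h ^+ 3); first by field_nz.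
  by rewrite jh; field_nz.
Qed.

(** The vector lies on the line y = 0, which is a double root of the cubic:
    exactly the pairs on which diag(t, 1/t) has only positive weights. *)
Definition null_cubvec X := [&& cA X == 0, cB X == 0 & vy X == 0].

Lemma sl_equiv_shear k X : sl_equiv X (sl_act 1 k 0 1 X).
Proof. by exists 1, k, 0, 1; split=> //; rewrite mulr1 mulr0 subr0. Qed.

Lemma cubic_root B C D : exists z : F, z ^+ 3 + B * z ^+ 2 + C * z + D = 0.
Proof.
have [//|z zE] := @solve_monicpoly F 3 (fun i => [:: - D; - C; - B]`_i).
exists z; rewrite zE !big_ord_recl big_ord0 /=; ring.
Qed.

(** A root z of the cubic in the affine coordinate x / y is moved to (1, 0) by
    the matrix (0 1; -1 z), which sends (z, 1) to (1, 0). *)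
Lemma root_to_infinity X : vx X = 0 -> vy X = 0 ->
  exists2 Y, sl_equiv X Y & [/\ cA Y = 0, vx Y = 0 & vy Y = 0].
Proof.
case: X => A B C D x y /= -> ->.
have [->|An0] := eqVneq A 0.
  exists (sl_act 1 0 0 1 (Cubvec 0 B C D 0 0)); first exact: sl_equiv_shear.
  by rewrite /=; split; ring.
have [z zE] := cubic_root (B / A) (C / A) (D / A).
exists (sl_act 0 1 (- 1) z (Cubvec A B C D 0 0)).
  by exists 0, 1, (- 1), z; split=> //; ring.
rewrite /=; split; [|ring..].
by rewrite -[RHS](mulr0 A) -zE; field_nz.
Qed.

Lemma vector_to_e1 X : (vx X != 0) || (vy X != 0) ->
  exists2 Y, sl_equiv X Y & vx Y = 1 /\ vy Y = 0.
Proof.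
case: X => A B C D x y /= xy.
have [x0|xn0] := eqVneq x 0; last first.
  exists (sl_act x^-1 0 (- y) x (Cubvec A B C D x y)).
    by exists x^-1, 0, (- y), x; split=> //; field_nz.
  by rewrite /=; split; [field_nz|ring].
have yn0 : y != 0 by move: xy; rewrite x0 eqxx.
exists (sl_act 0 y^-1 (- y) 0 (Cubvec A B C D x y)).
  by exists 0, y^-1, (- y), 0; split=> //; field_nz.
by rewrite /= x0; split; [field_nz|ring].
Qed.

(** The stabilizer of (1, 0) is the group of shears.  It suffices to bring the
    cubic into one of the shapes of [normal_form]: the coefficients are then
    determined by the invariants. *)
Lemma reduce_with_vector X : vx X = 1 -> vy X = 0 ->
  exists2 Y, sl_equiv X Y & null_cubvec Y \/ Y = normal_form (invs Y).
Proof.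
have n4 : 4 != 0 :> F := natr_neq0 2 0.
have n12 : 12 != 0 :> F := natr_neq0 2 1.
have n108 : 108 != 0 :> F := natr_neq0 2 3.
case: X => A B C D x y /= -> ->.
have [A0|An0] := eqVneq A 0; last first.
  (* the shear that completes the cube *)
  set k := B / (3 * A).
  exists (sl_act 1 k 0 1 (Cubvec A B C D 1 0)); first exact: sl_equiv_shear.
  right; set C' := C - 2 * B * k + 3 * A * k ^+ 2.
  set D' := D - C * k + B * k ^+ 2 - A * k ^+ 3.
  have -> : sl_act 1 k 0 1 (Cubvec A B C D 1 0) = Cubvec A 0 C' D' 1 0.
    by rewrite /= /C' /D' /k; congr Cubvec; field_nz.
  rewrite invs_depressed /normal_form An0; congr Cubvec; field_nz.
rewrite A0.
have [B0|Bn0] := eqVneq B 0.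
  exists (sl_act 1 0 0 1 (Cubvec 0 B C D 1 0)); first exact: sl_equiv_shear.
  by left; rewrite B0 /null_cubvec /=; apply/and3P; split; apply/eqP; ring.
(* the shear that completes the square in B x^2 + C x y + D y^2 *)
set k := C / (2 * B).
exists (sl_act 1 k 0 1 (Cubvec 0 B C D 1 0)); first exact: sl_equiv_shear.
right; set D' := D - C * k + B * k ^+ 2.
have -> : sl_act 1 k 0 1 (Cubvec 0 B C D 1 0) = Cubvec 0 B 0 D' 1 0.
  by rewrite /= /D' /k; congr Cubvec; field_nz.
rewrite invs_simple_root /normal_form eqxx /=.
have -> /= : - 4 * B ^+ 2 != 0 by rewrite mulf_neq0 ?oppr_eq0 // expf_neq0.
have n8 : 8 != 0 :> F := natr_neq0 3 0.
by congr Cubvec; field_nz.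
Qed.

(** Without a vector only the discriminant survives.  If (1, 0) is a simple
    root, diag(B, 1/B) followed by a shear brings the cubic to x^2 y + D' y^3;
    this has a double root when D' = 0. *)
Lemma reduce_without_vector X : vx X = 0 -> vy X = 0 -> cA X = 0 ->
  exists2 Y, sl_equiv X Y & null_cubvec Y \/ Y = normal_form (invs Y).
Proof.
have n4 : 4 != 0 :> F := natr_neq0 2 0.
case: X => A B C D x y /= -> -> ->.
have [B0|Bn0] := eqVneq B 0.
  exists (sl_act 1 0 0 1 (Cubvec 0 B C D 0 0)); first exact: sl_equiv_shear.
  by left; rewrite B0 /null_cubvec /=; apply/and3P; split; apply/eqP; ring.
set D' := B ^+ 3 * (D - C ^+ 2 / (4 * B)).
have XE : sl_equiv (Cubvec 0 B C D 0 0) (Cubvec 0 1 0 D' 0 0).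
  exists B, (C / 2), 0, B^-1; split; first by field_nz.
  by rewrite /= /D'; congr Cubvec; field_nz.
have [D0|Dn0] := eqVneq D' 0.
  (* the double root (0, 1) of x^2 y is rotated to (1, 0) *)
  exists (sl_act 0 1 (- 1) 0 (Cubvec 0 1 0 D' 0 0)).
    by apply: sl_equiv_trans XE _; exists 0, 1, (- 1), 0; split=> //; ring.
  by left; rewrite D0 /null_cubvec /=; apply/and3P; split; apply/eqP; ring.
exists (Cubvec 0 1 0 D' 0 0) => //; right.
rewrite invs_no_vector /normal_form eqxx /=.
by congr Cubvec; field_nz.
Qed.

Lemma sl_equiv_normal_form X :
  (exists2 Y, sl_equiv X Y & null_cubvec Y) \/ sl_equiv X (normal_form (invs X)).
Proof.
suff [Y XY []]: exists2 Y, sl_equiv X Y & null_cubvec Y \/ Y = normal_form (invs Y).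
- by left; exists Y.
- by move=> YE; right; rewrite -(invs_sl_equiv XY) -YE.
have [/vector_to_e1|] := boolP ((vx X != 0) || (vy X != 0)).
  move=> [Y XY [xY yY]]; have [Z YZ ZP] := reduce_with_vector xY yY.
  by exists Z => //; apply: sl_equiv_trans YZ.
rewrite negb_or !negbK => /andP[/eqP x0 /eqP y0].
have [Y XY [AY xY yY]] := root_to_infinity x0 y0.
have [Z YZ ZP] := reduce_without_vector xY yY AY.
by exists Z => //; apply: sl_equiv_trans YZ.
Qed.

End NormalForms.

(** * Powers of the line of antisymmetric forms *)

Section Coordinates.
Variables (F : fieldType) (V : vectType F) (e : 2.-tuple V).
Hypothesis e_basis : basis_of {:V} e.
Hypothesis two_neq0 : 2 != 0 :> F.

Let e1 := e`_0.
Let e2 := e`_1.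

Lemma coord_e (i j : 'I_2) : coord e i e`_j = (i == j)%:R.
Proof. by rewrite coord_free ?(basis_free e_basis) // eq_sym. Qed.

Lemma coord_e1 (x y : F) : coord e 0 (x *: e1 + y *: e2) = x.
Proof.
by rewrite linearD !linearZ /= (coord_e 0 0) (coord_e 0 1) /= mulr1 mulr0 addr0.
Qed.

Lemma coord_e2 (x y : F) : coord e 1 (x *: e1 + y *: e2) = y.
Proof.
by rewrite linearD !linearZ /= (coord_e 1 0) (coord_e 1 1) /= mulr1 mulr0 add0r.
Qed.

Lemma coordsE v : v = coord e 0 v *: e1 + coord e 1 v *: e2.
Proof.
rewrite [LHS](coord_basis e_basis) ?memvf // !big_ord_recl big_ord0 addr0 /=.
by congr (_ + coord e _ v *: _); apply: val_inj.
Qed.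

(** Stated for values in any module, to serve both for forms and for
    multiplications. *)
Lemma bilin_formE (U : lmodType F) (w : V -> V -> U) x y z t :
  bilinear_for *:%R *:%R w ->
  w (x *: e1 + y *: e2) (z *: e1 + t *: e2) =
  (x * z) *: w e1 e1 + (x * t) *: w e1 e2 + (y * z) *: w e2 e1 + (y * t) *: w e2 e2.
Proof.
case=> wl wr.
have wlD a u u' v : w (a *: u + u') v = a *: w u v + w u' v by exact: wl.
have wrD a u u' v : w v (a *: u + u') = a *: w v u + w v u' by exact: wr.
have wl0 v : w 0 v = 0.
  by have := wlD (-1) 0 0 v; rewrite scaler0 addr0 scaleN1r addNr.
have wr0 v : w v 0 = 0.
  by have := wrD (-1) 0 0 v; rewrite scaler0 addr0 scaleN1r addNr.
have wlZ a u v : w (a *: u) v = a *: w u v.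
  by have := wlD a u 0 v; rewrite !addr0 wl0 addr0.
have wrZ a u v : w v (a *: u) = a *: w v u.
  by have := wrD a u 0 v; rewrite !addr0 wr0 addr0.
by rewrite wlD wlZ !wrD !wrZ !scalerDr !scalerA !addrA.
Qed.

Local Notation om := (omega e).

Lemma omega_antisym : antisym_form om.
Proof.
rewrite /antisym_form /omega; split; last by move=> v w; ring.
split=> u a v w /=; rewrite !linearP /=; rewrite /GRing.scale /=; ring.
Qed.

Lemma omega_e : om e1 e2 = 1.
Proof.
rewrite /omega (coord_e 0 0) (coord_e 0 1) (coord_e 1 0) (coord_e 1 1) /=.
by rewrite mulr1 mulr0 subr0.
Qed.

(** Antisymmetry makes a form alternating because 2 is invertible. *)
Lemma antisym_formE (w : V -> V -> F^o) v v' :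
  antisym_form w -> w v v' = om v v' * w e1 e2.
Proof.
case=> wb wa.
have w0 u : w u u = 0.
  have: 2 * w u u = 0 by rewrite mulr_natl mulr2n {2}wa subrr.
  by move/eqP; rewrite mulf_eq0 (negPf two_neq0) => /eqP.
rewrite [in LHS](coordsE v) [in LHS](coordsE v') bilin_formE // !w0.
by rewrite [w e2 e1]wa /omega /GRing.scale /=; ring.
Qed.

Lemma Lpow_tpow r : Lpow r (tpow om r).
Proof.
move=> x i; rewrite /tpow.
pose y v v' := dfwith x (i := i) (v, v').
have E v v' : \prod_(j < r) om (y v v' j).1 (y v v' j).2
    = om v v' * \prod_(j < r | j != i) om (x j).1 (x j).2 :> F.
  rewrite /y.
  rewrite (bigD1 i) //= dfwith_in /=; congr (_ * _).
  by apply: eq_bigr => j ji; rewrite dfwith_out // eq_sym.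
have [[ol orr] oa] := omega_antisym.
have olE u a v w : om (a *: v + w) u = a * om v u + om w u :> F by exact: ol.
have orE u a v w : om u (a *: v + w) = a * om u v + om u w :> F by exact: orr.
split; last by move=> v v'; rewrite !E oa mulNr.
by split=> u a v w /=; rewrite !E ?olE ?orE /GRing.scale /=; ring.
Qed.

Lemma LpowZ r a (t : Lform V r) : Lpow r t -> Lpow r (a *: t).
Proof.
move=> tL x i; have [[tl tr] ta] := tL x i.
pose y v v' := dfwith x (i := i) (v, v').
have tlE u b v w : t (y (b *: v + w) u) = b * t (y v u) + t (y w u) :> F.
  exact: tl.
have trE u b v w : t (y u (b *: v + w)) = b * t (y u v) + t (y u w) :> F.
  exact: tr.
rewrite -/y; have E v v' : (a *: t) (y v v') = a * t (y v v') by [].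
split; last by move=> v v'; rewrite !E ta mulrN.
by split=> u b v w /=; rewrite !E ?tlE ?trE /GRing.scale /=; ring.
Qed.

Definition frame r : 'I_r -> V * V := fun=> (e1, e2).
Arguments frame r : clear implicits.

Lemma tpow_frame r : tpow om r (frame r) = 1.
Proof. by rewrite /tpow big1 // => i _; rewrite omega_e. Qed.

(** L^r is a line spanned by the r-th power of omega: replacing the pairs of
    vectors by the basis one after the other extracts one factor omega at a
    time. *)
Lemma LpowE r (t : Lform V r) :
  Lpow r t -> t = t (frame r) *: tpow om r.
Proof.
move=> tL; apply/funext => x.
(* the arguments of x with the first k pairs replaced by the basis *)
pose y k : 'I_r -> V * V := fun i => if (i < k)%N then (e1, e2) else x i.
have step k : (k <= r)%N ->
    t x = (\prod_(i < r | (i < k)%N) om (x i).1 (x i).2) * t (y k).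
  elim: k => [|k IHk] kr.
    rewrite big_pred0 // mul1r; congr t; exact/funext.
  rewrite (IHk (ltnW kr)) [in RHS](bigD1 (Ordinal kr)) ?ltnSn //=.
  set i0 := Ordinal kr.
  have -> : y k = dfwith (y k) (i := i0) ((x i0).1, (x i0).2).
    apply/funext => i; case: dfwithP => //.
    by rewrite /y /= ltnn -surjective_pairing.
  rewrite (antisym_formE _ _ (tL _ _)) mulrCA !mulrA.
  congr (_ * _ * t _).
    by apply: eq_bigl => i; rewrite ltnS [in RHS]leq_eqVlt -val_eqE /=; case: ltngtP.
  apply/funext => i; case: dfwithP => [|j /eqP ij]; rewrite /y /= ?leqnn //.
  rewrite ltnS [in RHS]leq_eqVlt; case: eqP => //= jk.
  by case: ij; apply/val_inj; rewrite /= jk.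
have := step r (leqnn r).
rewrite (eq_bigl predT) => [->|i]; last by rewrite /= ltn_ord.
rewrite mulrC; congr (t _ * _); apply/funext => i; by rewrite /y ltn_ord.
Qed.

Lemma scale_tpow_inj r : injective (fun a : F => a *: tpow om r : Lform V r).
Proof.
move=> a b /(congr1 (fun t => t (frame r))).
have E c : (c *: tpow om r) (frame r) = c * tpow om r (frame r) by [].
by rewrite /= !E tpow_frame !mulr1.
Qed.

Lemma tens_tpow r s (a b : F) :
  tens (a *: tpow om r) (b *: tpow om s) = (a * b) *: tpow om (r + s).
Proof.
apply/funext => x.
rewrite /tens /tpow /GRing.scale /= big_split_ord /=; rewrite /GRing.scale /=; ring.
Qed.

(** Scalars as coordinates on L^2 x L^2 x L^2 x L^3. *)
Definition forms (t : F * F * F * F) : quadruple V :=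
  let: (a, b, d, c) := t in
  (a *: tpow om 2, b *: tpow om 2, d *: tpow om 2, c *: tpow om 3).

Lemma forms_inj : injective forms.
Proof.
move=> [[[a b] d] c] [[[a' b'] d'] c'] [].
by do 4!move=> /scale_tpow_inj ->.
Qed.

Lemma forms0 : forms (0, 0, 0, 0) = 0.
Proof. by rewrite /forms !scale0r. Qed.

(** Both sides of the defining equation are multiples of the sixth power of
    omega, so the equation of forms is an equation of scalars. *)
Lemma Gamma_EisensteinP (p : quadruple V) :
  Gamma_Eisenstein V p <->
  exists a b d c, [/\ p = forms (a, b, d, c), (a, b, d, c) <> (0, 0, 0, 0)
    & 27 * d * a ^+ 2 + 4 * b ^+ 3 = - (2 ^+ 4 * 3 ^+ 6) * c ^+ 2].
Proof.
have key a b d c :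
  (27 *: tens (d *: tpow om 2) (tens (a *: tpow om 2) (a *: tpow om 2))
   + 4 *: tens (b *: tpow om 2) (tens (b *: tpow om 2) (b *: tpow om 2))
   = - (2 ^+ 4 * 3 ^+ 6) *: tens (c *: tpow om 3) (c *: tpow om 3) :> Lform V 6) <->
   27 * d * a ^+ 2 + 4 * b ^+ 3 = - (2 ^+ 4 * 3 ^+ 6) * c ^+ 2.
  rewrite !tens_tpow !scalerA -scalerDl.
  have -> : 27 * d * a ^+ 2 + 4 * b ^+ 3 =
    27 * (d * (a * a)) + 4 * (b * (b * b)) by ring.
  (* 2 + (2 + 2), 3 + 3 and 6 are convertible, hence so are the types *)
  rewrite expr2; split=> [|->//]; exact: (@scale_tpow_inj 6).
split.
  case: p => [[[A B] D] C] [[AL BL DL CL] nz].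
  move: nz; rewrite (LpowE AL) (LpowE BL) (LpowE DL) (LpowE CL).
  move=> nz /key H; do 4!eexists; split; [reflexivity| |exact: H].
  by move=> E; apply: nz; have := congr1 forms E; rewrite forms0.
case=> a [b [d [c [-> nz H]]]]; split.
- by split; apply/LpowZ/Lpow_tpow.
- by move=> E; apply/nz/forms_inj; rewrite forms0.
- exact/key.
Qed.

Lemma scale_forms (l a b d c : F) :
  scale_quadruple l (forms (a, b, d, c)) =
  forms (l ^- 2 * a, l ^- 2 * b, l ^- 2 * d, l ^- 3 * c).
Proof. by rewrite /= !scalerA. Qed.

End Coordinates.

(** * The action of GL(V) in coordinates *)

(** The dimension of V equals 2 only propositionally, while bases are indexed
    by the dimension when matrices of endomorphisms are formed.  The equality
    is abstracted into a variable here in order to be eliminated. *)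
Lemma tcast_coord (F : fieldType) (V : vectType F) n n' (E : n = n')
    (e : n.-tuple V) (i : 'I_n) :
  (tcast E e)`_(cast_ord E i) = e`_i /\
  coord (tcast E e) (cast_ord E i) = coord e i.
Proof. by case: _ / E; rewrite tcast_id cast_ord_id. Qed.

Lemma det_mx2 (R : comNzRingType) n (E : 2%N = n) (M : 'M[R]_n) :
  let i0 := cast_ord E 0 in let i1 := cast_ord E 1 in
  \det M = M i0 i0 * M i1 i1 - M i0 i1 * M i1 i0.
Proof.
case: _ / E M => M; rewrite /= !cast_ord_id.
rewrite (expand_det_row _ 0) !big_ord_recl big_ord0 addr0.
rewrite /cofactor !det_mx11 !mxE /= /bump /=.
have -> : lift ord0 ord0 = 1 :> 'I_2 by apply/val_inj.
have -> : lift 1 ord0 = 0 :> 'I_2 by apply/val_inj.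
by rewrite expr0 expr1 mul1r mulN1r mulrN.
Qed.

Section GroupAction.
Variables (F : fieldType) (V : vectType F).
Implicit Types (g h : 'End(V)) (m : V -> V -> V).

Lemma GL_comp g h : GL V g -> GL V h -> GL V (g \o h)%VF.
Proof.
move=> /lker0P gI /lker0P hI; apply/lker0P => v w.
by rewrite !comp_lfunE => /gI/hI.
Qed.

Lemma GL_inv g : GL V g -> GL V (g^-1)%VF.
Proof.
by move=> gI; apply/lker0P; apply: can_inj (lker0_lfunVK gI).
Qed.

Lemma GL_id : GL V \1%VF.
Proof. by apply/lker0P => v w; rewrite !id_lfunE. Qed.

Lemma act_id m : act \1%VF m = m.
Proof.
have idV v : (\1^-1)%VF v = v :> V.
  have id0 : lker (\1%VF : 'End(V)) == 0%VS := GL_id.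
  by have := lker0_lfunVK id0 v; rewrite id_lfunE.
by apply/funext => v; apply/funext => w; rewrite /act id_lfunE !idV.
Qed.

Lemma act_comp g h m : GL V g -> GL V h -> act (g \o h)%VF m = act g (act h m).
Proof.
move=> gI hI; have ghI := GL_comp gI hI.
have invE v : ((g \o h)^-1)%VF v = (h^-1)%VF ((g^-1)%VF v).
  by apply: (lker0P ghI); rewrite lker0_lfunVK // comp_lfunE !lker0_lfunVK.
by apply/funext => v; apply/funext => w; rewrite /act comp_lfunE !invE.
Qed.

Lemma Ac_act g m : Ac V m -> Ac V (act g m).
Proof.
move=> [[ml mr] ms]; split; last by move=> v w; rewrite /act ms.
have mlE u a v w : m (a *: v + w) u = a *: m v u + m w u by exact: ml.
have mrE u a v w : m u (a *: v + w) = a *: m u v + m u w by exact: mr.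
by split=> u a v w; rewrite /act linearP ?mlE ?mrE linearP.
Qed.

End GroupAction.

Section Bridge.
Variables (F : fieldType) (V : vectType F) (e : 2.-tuple V).
Hypothesis e_basis : basis_of {:V} e.
Implicit Types (g h : 'End(V)) (m : V -> V -> V).

Let e1 := e`_0.
Let e2 := e`_1.
Local Notation om := (omega e).

(** The determinant in the basis e, obtained without matrices as the factor by
    which g scales omega. *)
Definition edet g : F := om (g e1) (g e2).

Lemma omega_lfun g v w : om (g v) (g w) = edet g * om v w :> F.
Proof.
rewrite [in LHS](coordsE e_basis v) [in LHS](coordsE e_basis w).
rewrite !linearD !linearZ /= /edet /omega !linearD !linearZ /=; ring.
Qed.

Lemma edet_comp g h : edet (g \o h)%VF = edet g * edet h.
Proof. by rewrite /edet !comp_lfunE omega_lfun. Qed.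

Lemma edet1 : edet \1%VF = 1.
Proof. by rewrite /edet !id_lfunE omega_e. Qed.

Lemma edet_inv g : GL V g -> edet g * edet (g^-1)%VF = 1.
Proof. by move=> gI; rewrite -edet_comp lker0_compfV // edet1. Qed.

(** If g v = 0 then omega (v, w) = 0 for all w, because g scales omega by a
    nonzero factor; omega is nondegenerate. *)
Lemma GL_edet g : GL V g <-> edet g != 0.
Proof.
split=> [/edet_inv E|d].
  by apply/eqP => d; move/eqP: E; rewrite d mul0r eq_sym oner_eq0.
rewrite /GL /= -subv0; apply/subvP => v; rewrite memv_ker memv0 => /eqP gv.
have om0 w : om v w = 0.
  apply: (mulfI d); rewrite -omega_lfun gv mulr0 /omega !linear0; ring.
rewrite [v](coordsE e_basis).
have := om0 e1; have := om0 e2; rewrite /omega.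
have := coord_e e_basis; rewrite -/e1 -/e2 => ce.
rewrite (ce 0 0) (ce 0 1) (ce 1 0) (ce 1 1) /=.
rewrite !mulr1 !mulr0 !mul0r !mul1r subr0 sub0r.
by move=> -> /eqP; rewrite oppr_eq0 => /eqP ->; rewrite !scale0r addr0.
Qed.

Section Dim.
Hypothesis dimV : \dim {:V} = 2%N.

(** SL(V) is defined with the determinant in a reference basis of V; the
    change of basis matrices cancel. *)
Lemma SL_edet g : SL V g <-> edet g = 1.
Proof.
pose vb := vbasis {:V}.
have vbB : basis_of {:V} vb := vbasisP _.
pose e' := tcast (esym dimV) e.
have e'B : basis_of {:V} e' by rewrite /e' val_tcast.
have detE : \det (passmx.mxof vb vb g) = edet g.
  have -> : \det (passmx.mxof vb vb g) = \det (passmx.mxof e' e' g).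
    have id1 : passmx.mxof vb e' \1 *m passmx.mxof e' vb \1 = 1%:M.
      by rewrite -passmx.mxof_comp // comp_lfun1l passmx.mxof1 ?(basis_free vbB).
    have -> : passmx.mxof vb vb g
       = passmx.mxof vb e' \1 *m (passmx.mxof e' e' g *m passmx.mxof e' vb \1).
      by rewrite -!passmx.mxof_comp // comp_lfun1l comp_lfun1r.
    by rewrite !det_mulmx mulrCA -det_mulmx id1 det1 mulr1.
  rewrite (det_mx2 (esym dimV)) /=.
  have mE i j :
      passmx.mxof e' e' g (cast_ord (esym dimV) i) (cast_ord (esym dimV) j)
      = coord e j (g e`_i).
    rewrite !mxE /= passmx.vecof_delta.
    have [-> _] := tcast_coord (esym dimV) e i.
    by have [_ ->] := tcast_coord (esym dimV) e j.
  by rewrite !mE /edet /omega /= mulrC; congr (_ - _); rewrite mulrC.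
split=> [[_] | d]; first by rewrite detE.
by split; [apply/GL_edet; rewrite d oner_eq0 | rewrite detE].
Qed.

End Dim.

Definition end_fun (p q r s : F) (v : V) : V :=
  (p * coord e 0 v + q * coord e 1 v) *: e1
  + (r * coord e 0 v + s * coord e 1 v) *: e2.

Lemma end_fun_linear p q r s : linear (end_fun p q r s).
Proof.
move=> a v w.
have cP i : coord e i (a *: v + w) = a * coord e i v + coord e i w.
  by rewrite linearP.
rewrite /end_fun !cP !scalerDr !scalerA addrACA -!scalerDl.
by congr (_ *: _ + _ *: _); ring.
Qed.

HB.instance Definition _ p q r s :=
  GRing.isSemilinear.Build F V V _ (end_fun p q r s)
  (GRing.semilinear_linear (end_fun_linear p q r s)).

Definition end_of_entries p q r s : 'End(V) := linfun (end_fun p q r s).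

Lemma end_of_entriesE p q r s :
  [/\ end_of_entries p q r s e1 = p *: e1 + r *: e2,
      end_of_entries p q r s e2 = q *: e1 + s *: e2
    & edet (end_of_entries p q r s) = p * s - q * r].
Proof.
have ce := coord_e e_basis.
have E1 : end_of_entries p q r s e1 = p *: e1 + r *: e2.
  by rewrite lfunE /= /end_fun (ce 0 0) (ce 1 0) /= !mulr1 !mulr0 !addr0.
have E2 : end_of_entries p q r s e2 = q *: e1 + s *: e2.
  by rewrite lfunE /= /end_fun (ce 0 1) (ce 1 1) /= !mulr1 !mulr0 !add0r.
by split=> //; rewrite /edet E1 E2 /omega !(coord_e1 e_basis, coord_e2 e_basis).
Qed.

Lemma edet_surj l : exists g, edet g = l.
Proof.
exists (end_of_entries l 0 0 1); have [_ _ ->] := end_of_entriesE l 0 0 1.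
by rewrite mulr1 mulr0 subr0.
Qed.

(** The vector (d + e, - (a + f)) is tau; it represents the trace
    v |-> tr (m (v, _)) as omega (tau, v). *)
Definition cubvec_of m : cubvec F :=
  Cubvec (cub0 e m) (cub1 e m) (cub2 e m) (cub3 e m)
    (sc_d e m + sc_e e m) (- (sc_a e m + sc_f e m)).

(** With k = det g, the product g m (adj g _, adj g _) has cubic q o adj g and
    vector k g tau.  The inverse adj g / k occurs twice in the action, whence
    a factor k^-2 on both, which leaves k^-1 on g tau. *)
Definition rescale (k : F) (X : cubvec F) : cubvec F :=
  let: Cubvec A B C D x y := X in
  Cubvec (k ^- 2 * A) (k ^- 2 * B) (k ^- 2 * C) (k ^- 2 * D)
    (k^-1 * x) (k^-1 * y).

(** Equivariance of m |-> (q, tau), checked on structure constants. *)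
Lemma cubvec_of_act g m : GL V g -> Ac V m ->
  cubvec_of (act g m) = rescale (edet g)
    (sl_act (coord e 0 (g e1)) (coord e 0 (g e2))
            (coord e 1 (g e1)) (coord e 1 (g e2)) (cubvec_of m)).
Proof.
move=> gI [mb ms]; have /GL_edet d := gI.
set p := coord e 0 (g e1); set q := coord e 0 (g e2).
set r := coord e 1 (g e1); set s := coord e 1 (g e2).
have gE x y :
    g (x *: e1 + y *: e2) = (p * x + q * y) *: e1 + (r * x + s * y) *: e2.
  rewrite [LHS](coordsE e_basis) !linearD !linearZ /=.
  by congr (_ *: _ + _ *: _); rewrite -/p -/q -/r -/s; ring.
have dE : edet g = p * s - q * r by [].
pose k := (edet g)^-1.
(* k is kept as a symbol with det * k = 1, so that all identities are
   polynomial *)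
have kd : (p * s - q * r) * k = 1 by rewrite -dE divff.
have u1 : (g^-1)%VF e1 = (s * k) *: e1 + (- r * k) *: e2.
  apply: (lker0P gI); rewrite lker0_lfunVK // gE.
  have -> : p * (s * k) + q * (- r * k) = 1 by rewrite -kd; ring.
  have -> : r * (s * k) + s * (- r * k) = 0 by ring.
  by rewrite scale1r scale0r addr0.
have u2 : (g^-1)%VF e2 = (- q * k) *: e1 + (p * k) *: e2.
  apply: (lker0P gI); rewrite lker0_lfunVK // gE.
  have -> : r * (- q * k) + s * (p * k) = 1 by rewrite -kd; ring.
  have -> : p * (- q * k) + q * (p * k) = 0 by ring.
  by rewrite scale1r scale0r add0r.
have m11 : m e1 e1 = sc_a e m *: e1 + sc_b e m *: e2 := coordsE e_basis _.
have m22 : m e2 e2 = sc_c e m *: e1 + sc_d e m *: e2 := coordsE e_basis _.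
have m12 : m e1 e2 = sc_e e m *: e1 + sc_f e m *: e2 := coordsE e_basis _.
have m21 : m e2 e1 = sc_e e m *: e1 + sc_f e m *: e2 by rewrite ms.
have S v w x y z t :
    (g^-1)%VF v = x *: e1 + y *: e2 -> (g^-1)%VF w = z *: e1 + t *: e2 ->
    let u1 := x * z * sc_a e m + (x * t + y * z) * sc_e e m + y * t * sc_c e m in
    let u2 := x * z * sc_b e m + (x * t + y * z) * sc_f e m + y * t * sc_d e m in
    coord e 0 (act g m v w) = p * u1 + q * u2 /\
    coord e 1 (act g m v w) = r * u1 + s * u2.
  move=> vE wE u1' u2'; suff -> : act g m v w = g (u1' *: e1 + u2' *: e2).
    by rewrite gE (coord_e1 e_basis) (coord_e2 e_basis).
  rewrite /act vE wE bilin_formE // m11 m12 m21 m22; congr (g _).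
  have add2 a b a' b' :
      (a *: e1 + b *: e2) + (a' *: e1 + b' *: e2) =
      (a + a') *: e1 + (b + b') *: e2.
    by rewrite addrACA -!scalerDl.
  have scale2 l a b : l *: (a *: e1 + b *: e2) = (l * a) *: e1 + (l * b) *: e2.
    by rewrite scalerDr !scalerA.
  rewrite !scale2 !add2.
  by rewrite /u1' /u2'; congr (_ *: _ + _ *: _); ring.
have [sa sb] := S _ _ _ _ _ _ u1 u1.
have [sc sd] := S _ _ _ _ _ _ u2 u2.
have [se sf] := S _ _ _ _ _ _ u1 u2.
rewrite /cubvec_of /cub0 /cub1 /cub2 /cub3.
rewrite (sa : sc_a e (act g m) = _) (sb : sc_b e (act g m) = _).
rewrite (sc : sc_c e (act g m) = _) (sd : sc_d e (act g m) = _).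
rewrite (se : sc_e e (act g m) = _) (sf : sc_f e (act g m) = _).
rewrite /= -exprVn -/k.
congr Cubvec; [ring|ring|ring|ring| |]; rewrite -[RHS]mul1r -{1}kd; ring.
Qed.

End Bridge.

(** * The invariants of an algebra *)

Section Zeta.
Variables (F : fieldType) (V : vectType F) (e : 2.-tuple V).
Hypothesis e_basis : basis_of {:V} e.
Hypotheses (two_neq0 : 2 != 0 :> F) (three_neq0 : 3 != 0 :> F).
Implicit Types (g h : 'End(V)) (m : V -> V -> V) (X : cubvec F).

Let e1 := e`_0.
Let e2 := e`_1.

Definition zeta_scalars X : F * F * F * F :=
  (- 8 * cub_val X, hess_val X, disc X, 54^-1 * jac_val X).

(** Only constants, sums, products and the two variables occur below; together
    with this case the usual rules differentiate everything. *)
Lemma mderivXU (i j : 'I_2) : ('X_i : {mpoly F[2]})^`M(j) = ((i == j)%:R)%:MP.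
Proof.
rewrite mderivX mnm1E; case: eqP => [->|_]; last by rewrite scale0r mpolyC0.
by rewrite scale1r -{1}(addm0 (mnm1 j)) addmC addmK mpolyX0.
Qed.

(* The cubic of m with the pair of variables as its vector: evaluating the
   polynomials of the definition of zeta amounts to mapping the invariants of
   this pair. *)
Local Notation generic m := (Cubvec (cub0 e m)%:MP (cub1 e m)%:MP (cub2 e m)%:MP
  (cub3 e m)%:MP ('X_0 : {mpoly F[2]}) 'X_1).

Lemma cubicE m : cubic e m = cub_val (generic m).
Proof. by rewrite /cubic -!mul_mpolyC /cub_val /= !mulrA. Qed.

Lemma mderiv_cubic m :
  (cubic e m)^`M(0) = cubx (generic m) /\ (cubic e m)^`M(1) = cuby (generic m).
Proof.
rewrite cubicE /cub_val /cubx /cuby /=.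
rewrite !(mderivD, mderivM, mderivXU, mderivC, exprS, expr0) /=.
by rewrite !(mpolyC0, mpolyC1, mpolyC_nat); split; ring.
Qed.

Lemma mderiv_nat (n : nat) i : (n%:R : {mpoly F[2]})^`M(i) = 0.
Proof. by rewrite -mpolyC_nat mderivC. Qed.

Lemma hessE m : hess e m = hess_val (generic m).
Proof.
rewrite /hess; have [-> ->] := mderiv_cubic m.
rewrite /cubx /cuby /hess_val /hessA /hessB /hessC /=.
rewrite !(mderivD, mderivM, mderivXU, mderivC, exprS, expr0, mderiv_nat) /=.
by rewrite !(mpolyC0, mpolyC1, mpolyC_nat); ring.
Qed.

Lemma jacE m : jac e m = jac_val (generic m).
Proof.
rewrite /jac hessE; have [-> ->] := mderiv_cubic m.
rewrite /jac_val; congr (_ * _ - _ * _).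
all: rewrite /hess_val /hessx /hessy /hessA /hessB /hessC /=.
all: rewrite !(mderivD, mderivN, mderivM, mderivXU, mderivC, exprS, expr0,
               mderiv_nat) /=.
all: rewrite !(mpolyC0, mpolyC1, mpolyC_nat); ring.
Qed.

Lemma zetaE m : zeta e m = forms e (zeta_scalars (cubvec_of e m)).
Proof.
rewrite /zeta /p3 /Defs.p2 /Defs.Disc /Defs.Inv cubicE hessE jacE.
rewrite /zeta_scalars /forms.
have := invs_map (meval (tau e m)) (generic m).
rewrite /invs /= !mevalC !mevalXU /= -/(cubvec_of e m).
by case=> <- <- _ <-.
Qed.

(** For g of determinant k, [sl_act] multiplies the invariants by k^3, k^4,
    k^6, k^6; rescaling the cubic by k^-2 and the vector by k^-1 multiplies
    them by k^-5, k^-6, k^-8, k^-9. *)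
Lemma zeta_act g m : GL V g -> Ac V m ->
  zeta e (act g m) = scale_quadruple (edet e g) (zeta e m).
Proof.
move=> gG mA; have d := (GL_edet e_basis g).1 gG.
rewrite !zetaE (cubvec_of_act e_basis) // scale_forms; congr (forms e _).
set p := coord e 0 (g e1); set q := coord e 0 (g e2).
set r := coord e 1 (g e1); set s := coord e 1 (g e2).
have dE : p * s - q * r = edet e g by [].
have := cub_val_sl_act p q r s (cubvec_of e m).
have := hess_val_sl_act p q r s (cubvec_of e m).
have := disc_sl_act p q r s (cubvec_of e m).
have := jac_val_sl_act p q r s (cubvec_of e m).
rewrite dE; case: (sl_act p q r s (cubvec_of e m)) => A B C D x y Hj Hd Hh Hc.
set k := edet e g in d Hj Hd Hh Hc *.
rewrite /zeta_scalars; congr (_, _, _, _).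
- transitivity (k ^- 2 * (- 8 * (k ^- 3 * (k ^+ 3 * cub_val (cubvec_of e m))))).
    rewrite -Hc /cub_val /=; field_nz.
  by rewrite mulKf // expf_neq0.
- transitivity (k ^- 2 * (k ^- 4 * (k ^+ 4 * hess_val (cubvec_of e m)))).
    by rewrite -Hh /hess_val /hessA /hessB /hessC /=; field_nz.
  by rewrite mulKf // expf_neq0.
- transitivity (k ^- 2 * (k ^- 6 * (k ^+ 6 * disc (cubvec_of e m)))).
    by rewrite -Hd /disc /=; field_nz.
  by rewrite mulKf // expf_neq0.
- transitivity (k ^- 3 * (54^-1 * (k ^- 6 * (k ^+ 6 * jac_val (cubvec_of e m))))).
    rewrite -Hj /jac_val /cubx /cuby /hessx /hessy /hessA /hessB /hessC /=.
    rewrite [RHS]mulrCA; congr (_ * _); field_nz.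
  by rewrite mulKf // expf_neq0.
Qed.

(** The inverse of [cubvec_of]: solving C = 2 e - d, x = d + e for d, e and
    B = a - 2 f, y = - (a + f) for a, f requires 1/3. *)
Definition algebra_of X : V -> V -> V :=
  let: Cubvec A B C D x y := X in
  let ce := (C + x) / 3 in let cf := - (y + B) / 3 in
  fun v w =>
    let v1 := coord e 0 v in let v2 := coord e 1 v in
    let w1 := coord e 0 w in let w2 := coord e 1 w in
    ((- y - cf) * (v1 * w1) + ce * (v1 * w2 + v2 * w1) + D * (v2 * w2)) *: e1
    + (- A * (v1 * w1) + cf * (v1 * w2 + v2 * w1) + (x - ce) * (v2 * w2)) *: e2.

Lemma Ac_algebra_of X : Ac V (algebra_of X).
Proof.
case: X => A B C D x y; split; last first.
  by move=> v w; rewrite /algebra_of; congr (_ *: _ + _ *: _); ring.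
have add2 k a b a' b' : k *: (a *: e1 + b *: e2) + (a' *: e1 + b' *: e2) =
    (k * a + a') *: e1 + (k * b + b') *: e2.
  by rewrite scalerDr !scalerA addrACA -!scalerDl.
have cP a v w i : coord e i (a *: v + w) = a * coord e i v + coord e i w.
  by rewrite linearP.
by split=> u a v w; rewrite /algebra_of !cP add2; congr (_ *: _ + _ *: _); ring.
Qed.

Lemma cubvec_of_algebra_of X : cubvec_of e (algebra_of X) = X.
Proof.
case: X => A B C D x y.
rewrite /cubvec_of /cub0 /cub1 /cub2 /cub3 /sc_a /sc_b /sc_c /sc_d /sc_e /sc_f.
have ce := coord_e e_basis.
rewrite /algebra_of !(coord_e1 e_basis) !(coord_e2 e_basis).
rewrite (ce 0 0) (ce 0 1) (ce 1 0) (ce 1 1) /=.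
by congr Cubvec; field_nz.
Qed.

Lemma Ac_eq_on_basis m m' : Ac V m -> Ac V m' ->
  [/\ m e1 e1 = m' e1 e1, m e1 e2 = m' e1 e2 & m e2 e2 = m' e2 e2] -> m = m'.
Proof.
move=> [mb ms] [mb' ms'] [E11 E12 E22]; apply/funext => v; apply/funext => w.
rewrite (coordsE e_basis v) (coordsE e_basis w) !bilin_formE //.
by rewrite -/e1 -/e2 [m e2 e1]ms [m' e2 e1]ms' E11 E12 E22.
Qed.

Lemma algebra_ofK m : Ac V m -> algebra_of (cubvec_of e m) = m.
Proof.
move=> mA; apply: Ac_eq_on_basis => //; first exact: Ac_algebra_of.
have ce := coord_e e_basis.
rewrite /algebra_of /cubvec_of (ce 0 0) (ce 0 1) (ce 1 0) (ce 1 1) /=.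
rewrite [m e1 e1](coordsE e_basis) [m e1 e2](coordsE e_basis).
rewrite [m e2 e2](coordsE e_basis).
rewrite /cub0 /cub1 /cub2 /cub3 -/(sc_a e m) -/(sc_b e m) -/(sc_c e m).
rewrite -/(sc_d e m) -/(sc_e e m) -/(sc_f e m).
by split; congr (_ *: _ + _ *: _); field_nz.
Qed.

Lemma cubvec_of_inj m m' :
  Ac V m -> Ac V m' -> cubvec_of e m = cubvec_of e m' -> m = m'.
Proof. by move=> mA mA' E; rewrite -(algebra_ofK mA) E algebra_ofK. Qed.

End Zeta.

(** * Stability *)

Section Homogeneity.
Variables (F : fieldType) (n : nat) (X : cubvec {mpoly F[n]}).
Hypothesis X_lin : [/\ cA X \is 1.-homog, cB X \is 1.-homog, cC X \is 1.-homog,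
  cD X \is 1.-homog & vx X \is 1.-homog /\ vy X \is 1.-homog].

Lemma homog_nat k : (k%:R : {mpoly F[n]}) \is 0.-homog.
Proof. by rewrite -mpolyC_nat -[_%:MP]mulr1 mul_mpolyC rpredZ // dhomog1. Qed.

Lemma invs_homog :
  [/\ cub_val X \is 4.-homog, hess_val X \is 4.-homog, disc X \is 4.-homog
    & jac_val X \is 6.-homog].
Proof.
case: X X_lin => A B C D x y /= [AH BH CH DH [xH yH]]; unfold_invs.
have M p q d d' k : p \is d.-homog -> q \is d'.-homog -> k = (d + d')%N ->
  (p * q : {mpoly F[n]}) \is k.-homog by move=> ? ? ->; apply: dhomogM.
have XE p d i k : p \is d.-homog -> k = (d * i)%N ->
  (p ^+ i : {mpoly F[n]}) \is k.-homog by move=> ? ->; apply: dhomogMn.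
split; repeat first [exact: homog_nat | eassumption | apply: rpredD |
  apply: rpredB | rewrite rpredN | eapply M | eapply XE | reflexivity].
Qed.

End Homogeneity.

(** An algebraically closed field is infinite.  In the form used here:
    'X (p - k) + 1 takes the value 1 everywhere, so has no root and is
    constant. *)
Lemma poly_const_off_0 (F : closedFieldType) (p : {poly F}) k :
  (forall t, t != 0 -> p.[t] = k) -> p = k%:P.
Proof.
move=> pk; pose q := 'X * (p - k%:P) + 1.
have qE t : q.[t] = 1.
  rewrite /q hornerD hornerM hornerX hornerD hornerN -[1]/(1%:P) !hornerC.
  have [->|/pk->] := eqVneq t 0; first by rewrite mul0r add0r.
  by rewrite subrr mulr0 add0r.
have : size q == 1 by apply: contraT => /closed_rootP [x]; rewrite /root qE oner_eq0.
move=> /size_poly1P[c _ qc].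
have c1 : c = 1 by have := qE 0; rewrite qc hornerC.
apply/eqP; rewrite -subr_eq0; apply/eqP/(mulfI (negbT (polyX_eq0 F))).
by apply: (addIr 1); rewrite mulr0 add0r -/q qc c1.
Qed.

(** The Hilbert-Mumford argument: t |-> P (t^w c) is a polynomial in t that is
    constant for nonzero t, and vanishes at t = 0 as every monomial of P
    involves a variable of positive weight. *)
Lemma homog_positive_weights (F : closedFieldType) (n d : nat) (P : {mpoly F[n]})
    (c : 'I_n -> F) (w : 'I_n -> nat) k :
  (0 < d)%N -> P \is d.-homog -> (forall i, 0 < w i)%N ->
  (forall t, t != 0 -> P.@[fun i => t ^+ w i * c i] = k) -> k = 0.
Proof.
move=> d0 Ph w0 Pk.
pose p : {poly F} := \sum_(m <- msupp P)
  (P@_m * \prod_i c i ^+ m i) *: \prod_i 'X ^+ (w i * m i).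
have pE t : p.[t] = P.@[fun i => t ^+ w i * c i].
  rewrite horner_sum mevalE; apply: eq_bigr => m _.
  rewrite hornerZ horner_prod -mulrA -big_split /=; congr (_ * _).
  by apply: eq_bigr => i _; rewrite hornerXn exprMn exprM mulrC.
have p0 : p.[0] = 0.
  rewrite horner_sum big_seq big1 // => m mP.
  have md : mdeg m = d by apply: dhomog_mf Ph _ mP.
  have [i mi] : exists i, (0 < m i)%N.
    apply/existsP; apply: contraTT d0; rewrite negb_exists -md mdegE => /forallP m0.
    by rewrite big1 // => i _; apply/eqP; have := m0 i; rewrite lt0n negbK.
  rewrite hornerZ horner_prod [X in _ * X](bigD1 i) //= hornerXn expr0n muln_eq0.
  by rewrite (gtn_eqF (w0 i)) (gtn_eqF mi) mul0r mulr0.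
have pk : p = k%:P by apply: poly_const_off_0 => t t0; rewrite pE Pk.
by rewrite -p0 pk hornerC.
Qed.

Section Stability.
Variables (F : closedFieldType) (V : vectType F) (e : 2.-tuple V).
Hypothesis e_basis : basis_of {:V} e.
Hypotheses (two_neq0 : 2 != 0 :> F) (three_neq0 : 3 != 0 :> F).
Hypothesis dimV : \dim {:V} = 2%N.
Implicit Types (g h : 'End(V)) (m : V -> V -> V) (X Y : cubvec F).

Let e1 := e`_0.
Let e2 := e`_1.

Lemma rescale1 X : rescale 1 X = X.
Proof. by case: X => *; rewrite /rescale expr1n invr1 !mul1r. Qed.

Lemma SL_GL g : SL V g -> GL V g.
Proof. by case. Qed.

Lemma invs_act_SL g m : SL V g -> Ac V m ->
  invs (cubvec_of e (act g m)) = invs (cubvec_of e m).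
Proof.
move=> gS mA; have d := (SL_edet e_basis dimV g).1 gS.
rewrite (cubvec_of_act e_basis (SL_GL gS) mA) d rescale1; apply: invs_sl_equiv.
by do 4!eexists; split; last reflexivity; rewrite -d.
Qed.

Lemma end_of_entries_SL p q r s :
  p * s - q * r = 1 -> SL V (end_of_entries e p q r s).
Proof.
move=> d; apply/(SL_edet e_basis dimV).
by have [_ _ ->] := end_of_entriesE e_basis p q r s.
Qed.

Lemma cubvec_of_act_entries p q r s m : p * s - q * r = 1 -> Ac V m ->
  cubvec_of e (act (end_of_entries e p q r s) m) = sl_act p q r s (cubvec_of e m).
Proof.
move=> d mA; rewrite (cubvec_of_act e_basis (SL_GL (end_of_entries_SL d)) mA).
have [-> -> ->] := end_of_entriesE e_basis p q r s.
by rewrite !(coord_e1 e_basis, coord_e2 e_basis) d rescale1.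
Qed.

Lemma sl_equiv_lift m Y : Ac V m -> sl_equiv (cubvec_of e m) Y ->
  exists2 g, SL V g & cubvec_of e (act g m) = Y.
Proof.
move=> mA [p [q [r [s [d ->]]]]]; exists (end_of_entries e p q r s).
  exact: end_of_entries_SL.
exact: cubvec_of_act_entries.
Qed.

(** The structure constants (a, b, c, d, e, f) in terms of (q, tau). *)
Definition consts_of X : 'I_6 -> F :=
  let: Cubvec A B C D x y := X in
  tnth [tuple - y + (y + B) / 3; - A; D; x - (C + x) / 3; (C + x) / 3;
    - (y + B) / 3].

Lemma struct_constsE m : struct_consts e m =1 consts_of (cubvec_of e m).
Proof.
move=> i; congr (tnth _ i); apply/val_inj.
by rewrite /= /cub0 /cub1 /cub2 /cub3; do 6?congr (_ :: _); field_nz.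
Qed.

(** For a null pair b = a = f = 0, and diag(t, 1/t) multiplies c by t^3 and d,
    e by t. *)
Lemma null_unstable m : Ac V m -> null_cubvec (cubvec_of e m) -> ~ Ac_st e m.
Proof.
move=> mA mN [_ [d [f [d0 [P Ph fP] f_inv /eqP[]]]]].
(* a, b, f vanish, so that any positive weight fits them *)
pose w : 'I_6 -> nat := tnth [tuple 1; 1; 3; 1; 1; 1]%N.
apply: (@homog_positive_weights F 6 d P (struct_consts e m) w) => //.
  by case=> -[|[|[|[|[|[|]]]]]].
move=> t tn0; have dt : t * t^-1 - 0 * 0 = 1 by rewrite mulr0 subr0 divff.
rewrite -(f_inv _ _ (end_of_entries_SL dt) mA) fP; last exact: Ac_act.
apply: meval_eq => i.
rewrite !struct_constsE (cubvec_of_act_entries dt mA); move: mN.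
case: (cubvec_of e m) => A B C D x y /and3P[/= /eqP -> /eqP -> /eqP ->].
rewrite !(tnth_nth 0) /w (tnth_nth 0%N).
case: i => -[|[|[|[|[|[|]]]]]] //= _; field_nz.
Qed.

Lemma stable_act g m : SL V g -> Ac V m -> Ac_st e m -> Ac_st e (act g m).
Proof.
move=> gS mA [_ [d [f [d0 fh f_inv fm]]]]; split; first exact: Ac_act.
by exists d, f; split=> //; rewrite f_inv.
Qed.

(** The pair (q, tau) as a function of the structure constants a, ..., f,
    numbered 0, ..., 5. *)
Definition generic_cubvec : cubvec {mpoly F[6]} :=
  Cubvec (- 'X_1) ('X_0 - 2 * 'X_5) (2 * 'X_4 - 'X_3) 'X_2
    ('X_3 + 'X_4) (- ('X_0 + 'X_5)).

Lemma invs_generic m :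
  invs (cubvec_of e m) =
  let ev := meval (struct_consts e m) in
  (ev (cub_val generic_cubvec), ev (hess_val generic_cubvec),
   ev (disc generic_cubvec), ev (jac_val generic_cubvec)).
Proof.
have /= <- := invs_map (meval (struct_consts e m)) generic_cubvec.
congr invs.
rewrite !(rmorph_nat, mevalB, mevalN, mevalD, mevalM, mevalXU).
by rewrite /struct_consts !(tnth_nth 0).
Qed.

Lemma homog_var i : ('X_i : {mpoly F[6]}) \is 1.-homog.
Proof. by rewrite dhomogX /= mdeg1. Qed.

Lemma invs_stable m : Ac V m -> invs (cubvec_of e m) <> (0, 0, 0, 0) -> Ac_st e m.
Proof.
move=> mA mN; split=> //.
have var2_homog i : (2 * 'X_i : {mpoly F[6]}) \is 1.-homog.
  exact: dhomogM (homog_nat _ _ 2) (homog_var i).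
have [|cub_h hess_h disc_h jac_h] := @invs_homog F 6 generic_cubvec.
  rewrite /=; split; [| | | |split];
    by rewrite ?rpredN ?rpredB ?rpredD ?var2_homog ?homog_var.
have stab d (P : {mpoly F[6]}) : (0 < d)%N -> P \is d.-homog ->
    (forall m m' : V -> V -> V, invs (cubvec_of e m) = invs (cubvec_of e m') ->
       P.@[struct_consts e m] = P.@[struct_consts e m']) ->
    P.@[struct_consts e m] != 0 ->
  exists d f, [/\ (0 < d)%N, is_homog_poly e d f, SL_invariant f & f m != 0].
  move=> d0 Ph Pinv Pm; exists d, (fun m => P.@[struct_consts e m]); split=> //.
    by exists P.
  by move=> g m' gS m'A; apply/Pinv/invs_act_SL.
have [E1|] := eqVneq (cub_val generic_cubvec).@[struct_consts e m] 0; last first.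
  by apply: stab cub_h _ => // m1 m2; rewrite !invs_generic => -[].
have [E2|] := eqVneq (hess_val generic_cubvec).@[struct_consts e m] 0; last first.
  by apply: stab hess_h _ => // m1 m2; rewrite !invs_generic => -[].
have [E3|] := eqVneq (disc generic_cubvec).@[struct_consts e m] 0; last first.
  by apply: stab disc_h _ => // m1 m2; rewrite !invs_generic => -[].
have [E4|] := eqVneq (jac_val generic_cubvec).@[struct_consts e m] 0; last first.
  by apply: stab jac_h _ => // m1 m2; rewrite !invs_generic => -[].
by case: mN; rewrite invs_generic /= E1 E2 E3 E4.
Qed.

(** A stable algebra is not equivalent to a null one, so it has a normal form.
    Its invariants cannot all vanish, since the normal form attached to zero is
    x^2 y without vector, which is equivalent to a null pair. *)
Lemma stable_normal_form m : Ac_st e m ->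
  invs (cubvec_of e m) <> (0, 0, 0, 0) /\
  exists2 g, SL V g & cubvec_of e (act g m) = normal_form (invs (cubvec_of e m)).
Proof.
move=> mst; have mA : Ac V m by case: mst.
have not_null Y : sl_equiv (cubvec_of e m) Y -> ~ null_cubvec Y.
  move=> /(sl_equiv_lift mA)[g gS <-] /(null_unstable (Ac_act g mA)); apply.
  exact: stable_act.
have [[Y mY /(not_null _ mY)]//|mnf] :=
  sl_equiv_normal_form two_neq0 three_neq0 (cubvec_of e m).
split; last exact: sl_equiv_lift.
move=> m0; move: mnf; rewrite m0 /normal_form eqxx /= oppr0 mul0r => mE.
apply: (not_null (sl_act 0 1 (- 1) 0 (Cubvec 0 1 0 0 0 0))).
  by apply: sl_equiv_trans mE _; exists 0, 1, (- 1), 0; split=> //; ring.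
by rewrite /null_cubvec /=; apply/and3P; split; apply/eqP; ring.
Qed.

End Stability.

(** * Orbit spaces *)

(* The action is described by existence statements, which only speak of the
   effect of its elements on points; so the same lemmas serve for linear maps
   under composition and for scalars under multiplication. *)
Section QuotientBijection.
Variables (T X : Type) (G : set T) (act : T -> X -> X).
Hypothesis act_one : exists2 g, G g & forall x, act g x = x.
Hypothesis act_mul : forall g h, G g -> G h ->
  exists2 k, G k & forall x, act k x = act g (act h x).
Hypothesis act_inv : forall g, G g -> exists2 k, G k & forall x, act k (act g x) = x.

Lemma act_orbit_refl x : act_orbit G act x x.
Proof. by have [g gG gE] := act_one; exists g. Qed.

Lemma act_orbit_eq g x : G g -> act_orbit G act (act g x) = act_orbit G act x.
Proof.
move=> gG; apply/seteqP; split=> _ [h hG <-].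
  by have [k kG kE] := act_mul hG gG; exists k.
have [k kG kE] := act_inv gG; have [l lG lE] := act_mul hG kG.
by exists l; rewrite // lE kE.
Qed.

(** An invariant function that separates the orbits descends to a bijection
    from the quotient onto its image.  The point x0 provides a value on
    the empty set. *)
Lemma quotient_bij (Y : set X) (Z : Type) (B : set Z) (k : X -> Z) (x0 : X) :
    (forall g x, G g -> Y x -> k (act g x) = k x) ->
    (forall x y, Y x -> Y y -> k x = k y -> exists2 g, G g & act g x = y) ->
    (forall x, Y x -> B (k x)) ->
    (forall b, B b -> exists2 x, Y x & k x = b) ->
  exists phi : set X -> Z, (forall x, Y x -> phi (act_orbit G act x) = k x) /\
    set_bij (act_quotient G act Y) B phi.
Proof.
move=> k_inv k_sep k_in k_surj.
pose phi O :=
  if pselect (exists x, O x) is left ex then k (projT1 (cid ex)) else k x0.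
have phiE x : Y x -> phi (act_orbit G act x) = k x.
  move=> Yx; rewrite /phi; case: pselect => [ex|[]]; last first.
    by exists x; apply: act_orbit_refl.
  case: (cid ex) => y yO /=; case: yO => g gG <-; exact: k_inv.
exists phi; split=> //; split.
- by move=> _ [x Yx <-]; rewrite /= phiE //; apply: k_in.
- move=> _ _ /set_mem[x Yx <-] /set_mem[y Yy <-]; rewrite !phiE // => kxy.
  by have [g gG <-] := k_sep _ _ Yx Yy kxy; rewrite act_orbit_eq.
- move=> b /k_surj[x Yx kx]; exists (act_orbit G act x); first by exists x.
  by rewrite phiE.
Qed.

End QuotientBijection.

Section ZetaBijection.
Variables (F : closedFieldType) (V : vectType F) (e : 2.-tuple V).
Hypothesis e_basis : basis_of {:V} e.
Hypotheses (two_neq0 : 2 != 0 :> F) (three_neq0 : 3 != 0 :> F).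
Hypothesis dimV : \dim {:V} = 2%N.
Implicit Types (g h : 'End(V)) (m : V -> V -> V) (X Y : cubvec F).

Let n8 : 8 != 0 :> F := natr23_neq0 3 0 two_neq0 three_neq0.
Let n54 : 54 != 0 :> F := natr23_neq0 1 3 two_neq0 three_neq0.

Lemma zeta_scalars_eq X Y : zeta_scalars X = zeta_scalars Y <-> invs X = invs Y.
Proof.
rewrite /zeta_scalars /invs; split=> [[]|[-> -> -> ->]//].
have n8' : - 8 != 0 :> F by rewrite oppr_eq0 n8.
by move=> /(mulfI n8') -> -> -> /(mulfI (invr_neq0 n54)) ->.
Qed.

Lemma zeta_eq m m' :
  zeta e m = zeta e m' <-> invs (cubvec_of e m) = invs (cubvec_of e m').
Proof.
rewrite !zetaE -zeta_scalars_eq; split=> [|->//]; exact: (forms_inj e_basis).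
Qed.

Lemma SL_group : [/\ SL V \1%VF, forall g h, SL V g -> SL V h -> SL V (g \o h)%VF
  & forall g, SL V g -> SL V (g^-1)%VF].
Proof.
have P := SL_edet e_basis dimV; split.
- exact/P/(edet1 e_basis).
- by move=> g h /P dg /P dh; apply/P; rewrite edet_comp // dg dh mulr1.
- move=> g gS; apply/P; have := edet_inv e_basis (SL_GL gS).
  by rewrite ((P g).1 gS) mul1r.
Qed.

(** Both algebras are carried to the same normal form. *)
Lemma zeta_separates m m' : Ac_st e m -> Ac_st e m' -> zeta e m = zeta e m' ->
  exists2 g, SL V g & act g m = m'.
Proof.
move=> mst mst' /zeta_eq E.
have [[mA _] [mA' _]] := (mst, mst').
have [_ [g gS gE]] := stable_normal_form e_basis two_neq0 three_neq0 dimV mst.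
have [_ [g' gS' gE']] := stable_normal_form e_basis two_neq0 three_neq0 dimV mst'.
have [_ SLM SLV] := SL_group.
have {gE gE'}E : act g m = act g' m'.
  apply: (cubvec_of_inj e_basis three_neq0); rewrite ?gE ?gE' ?E //;
    exact: Ac_act.
exists (g'^-1 \o g)%VF; first by apply: SLM => //; apply: SLV.
rewrite act_comp ?E; [|exact/SL_GL/SLV|exact: SL_GL].
rewrite -act_comp; [|exact/SL_GL/SLV|exact: SL_GL].
by rewrite lker0_compVf ?act_id //; apply: SL_GL.
Qed.

Lemma zeta_Gamma m : Ac_st e m -> Gamma_Eisenstein V (zeta e m).
Proof.
move=> mst; have [m0 _] := stable_normal_form e_basis two_neq0 three_neq0 dimV mst.
apply/(Gamma_EisensteinP e_basis two_neq0); rewrite zetaE.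
do 4!eexists; split; first reflexivity.
  move=> E; apply: m0; rewrite -(invs_null (0 : F) 0 0); apply/zeta_scalars_eq.
  have [c0 h0 d0 j0] := invs_null (0 : F) 0 0.
  by rewrite {2}/zeta_scalars c0 h0 d0 j0 !mulr0.
have := syzygy (cubvec_of e m).
set a := cub_val _; set h := hess_val _; set d := disc _; set j := jac_val _.
move: (n54) => n54_ syz.
apply/eqP; rewrite -subr_eq0; apply/eqP.
transitivity (4 * (h ^+ 3 + j ^+ 2 + 432 * d * a ^+ 2)); last by rewrite syz mulr0.
by field_nz.
Qed.

(** The algebra of the normal form with the prescribed invariants; it is
    stable because they do not all vanish. *)
Lemma zeta_surj p : Gamma_Eisenstein V p -> exists2 m, Ac_st e m & zeta e m = p.
Proof.
move=> /(Gamma_EisensteinP e_basis two_neq0) [a [b [d [c [-> nz syz]]]]].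
have [n8_ n54_] := (n8, n54).
have n4 : 4 != 0 :> F := natr23_neq0 2 0 two_neq0 three_neq0.
pose t := (- a / 8, b, d, 54 * c).
have tE : invs (normal_form t) = t.
  apply: invs_normal_form => //; apply: (mulfI n4).
  rewrite mulr0.
  transitivity (27 * d * a ^+ 2 + 4 * b ^+ 3 - - (2 ^+ 4 * 3 ^+ 6) * c ^+ 2).
    by field_nz.
  by rewrite syz subrr.
have mA := Ac_algebra_of e (normal_form t).
have mE := cubvec_of_algebra_of e_basis three_neq0 (normal_form t).
exists (algebra_of e (normal_form t)).
  apply: invs_stable => //; rewrite mE tE /t => -[a0 b0 d0 c0]; apply: nz.
  have -> : a = 0.
    apply/eqP; rewrite -oppr_eq0 -(mulIr_eq0 _ (mulIf (invr_neq0 n8_))).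
    by rewrite a0.
  have -> : c = 0 by apply/(mulfI n54_); rewrite c0 mulr0.
  by rewrite b0 d0.
rewrite zetaE mE; congr forms; move: tE; rewrite /invs /zeta_scalars /t.
by case=> -> -> -> ->; congr (_, _, _, _); field_nz.
Qed.

Lemma scale_quadruple_comp (k l : F) (p : quadruple V) :
  scale_quadruple k (scale_quadruple l p) = scale_quadruple (k * l) p.
Proof. by case: p => [[[A B] D] C]; rewrite /= !scalerA !exprMn !invfM. Qed.

Lemma scale_quadruple1 (p : quadruple V) : scale_quadruple 1 p = p.
Proof. by case: p => [[[A B] D] C]; rewrite /= !expr1n !invr1 !scale1r. Qed.

Lemma scale_orbit (l : F) (p : quadruple V) : l != 0 ->
  act_orbit (Fstar F) scale_quadruple (scale_quadruple l p)
  = act_orbit (Fstar F) scale_quadruple p.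
Proof.
move=> ln0; apply: act_orbit_eq => // [k k' kn0 kn0'|k kn0].
  by exists (k * k') => [|x]; rewrite ?scale_quadruple_comp // /Fstar /= mulf_neq0.
exists k^-1 => [|x]; first by rewrite /Fstar /= invr_eq0.
by rewrite scale_quadruple_comp mulVf // scale_quadruple1.
Qed.

End ZetaBijection.

Theorem theorem1p5 (F : closedFieldType)
    (char2 : 2%N \notin [pchar F]) (char3 : 3%N \notin [pchar F])
    (V : vectType F) (dimV : \dim {:V} = 2%N)
    (e : 2.-tuple V) (e_basis : basis_of {:V} e) :
  exists2 zeta_s : set (V -> V -> V) -> quadruple V,
    (forall m, Ac_st e m -> zeta_s (act_orbit (SL V) act m) = zeta e m) /\
    set_bij (act_quotient (SL V) act (Ac_st e)) (Gamma_Eisenstein V) zeta_s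
  & exists2 zeta_g : set (V -> V -> V) -> set (quadruple V),
      forall m, Ac_st e m ->
        zeta_g (act_orbit (GL V) act m)
          = act_orbit (Fstar F) scale_quadruple
              (zeta_s (act_orbit (SL V) act m))
    & set_bij (act_quotient (GL V) act (Ac_st e))
        (act_quotient (Fstar F) scale_quadruple (Gamma_Eisenstein V))
        zeta_g.
Proof.
have two_neq0 : 2 != 0 :> F by move: char2; rewrite inE.
have three_neq0 : 3 != 0 :> F by move: char3; rewrite inE.
have [SL1 SLM SLV] := SL_group e_basis dimV.
have act_inv g m : GL V g -> act (g^-1)%VF (act g m) = m.
  by move=> gG; rewrite -act_comp ?lker0_compVf ?act_id //; apply: GL_inv.
have m0 : V -> V -> V := fun=> id.
have [zeta_s [zeta_sE zeta_s_bij]] :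
  exists zeta_s : set (V -> V -> V) -> quadruple V,
    (forall m, Ac_st e m -> zeta_s (act_orbit (SL V) act m) = zeta e m) /\
    set_bij (act_quotient (SL V) act (Ac_st e)) (Gamma_Eisenstein V) zeta_s.
  apply: (@quotient_bij _ _ (SL V) act _ _ _ (Ac_st e) _ _ (zeta e) m0).
  - by exists \1%VF => // m; rewrite act_id.
  - move=> g h gS hS; exists (g \o h)%VF => [|m]; first exact: SLM.
    by rewrite act_comp //; apply: SL_GL.
  - move=> g gS; exists (g^-1)%VF => [|m]; first exact: SLV.
    by rewrite act_inv //; apply: SL_GL.
  - move=> g m gS [mA _]; apply/(zeta_eq e_basis two_neq0 three_neq0).
    exact: invs_act_SL.
  - exact: zeta_separates.
  - exact: zeta_Gamma.
  - exact: zeta_surj.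
exists zeta_s => //.
have [zeta_g [zeta_gE zeta_g_bij]] :
  exists zeta_g : set (V -> V -> V) -> set (quadruple V),
    (forall m, Ac_st e m -> zeta_g (act_orbit (GL V) act m) =
       act_orbit (Fstar F) scale_quadruple (zeta e m)) /\
    set_bij (act_quotient (GL V) act (Ac_st e))
      (act_quotient (Fstar F) scale_quadruple (Gamma_Eisenstein V)) zeta_g.
  apply: (@quotient_bij _ _ (GL V) act _ _ _ (Ac_st e) _ _
    (fun m => act_orbit (Fstar F) scale_quadruple (zeta e m)) m0).
  - by exists \1%VF => [|m]; [exact: GL_id | rewrite act_id].
  - move=> g h gS hS; exists (g \o h)%VF => [|m]; first exact: GL_comp.
    by rewrite act_comp.
  - by move=> g gS; exists (g^-1)%VF => [|m]; [exact: GL_inv|rewrite act_inv].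
  - move=> g m gG [mA _]; rewrite zeta_act // scale_orbit //.
    exact/(GL_edet e_basis).
  - move=> m m' mst mst' E.
    have [l l0 lE] : act_orbit (Fstar F) scale_quadruple (zeta e m) (zeta e m').
      rewrite E; exists 1; first by rewrite /Fstar /= oner_eq0.
      by rewrite scale_quadruple1.
    (* a map of determinant l absorbs the factor between the two images *)
    have [g dE] := edet_surj e_basis l.
    have gG : GL V g by apply/(GL_edet e_basis); rewrite dE.
    have mA : Ac V m by case: mst.
    have gmE : zeta e (act g m) = zeta e m'.
      by rewrite (zeta_act e_basis gG mA) dE; exact: lE.
    have gst : Ac_st e (act g m).
      apply: (invs_stable e_basis dimV (Ac_act g mA)).
      rewrite ((zeta_eq e_basis two_neq0 three_neq0 _ _).1 gmE).
      by have [] := stable_normal_form e_basis two_neq0 three_neq0 dimV mst'.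
    have [h hS hE] := zeta_separates e_basis two_neq0 three_neq0 dimV gst mst' gmE.
    have hG := SL_GL hS; exists (h \o g)%VF; first exact: GL_comp hG gG.
    by rewrite (act_comp m hG gG) hE.
  - move=> m mst; exists (zeta e m) => //; exact: zeta_Gamma.
  - move=> _ [p pG <-].
    have [m mst <-] := zeta_surj e_basis two_neq0 three_neq0 dimV pG.
    by exists m.
by exists zeta_g => // m mst; rewrite zeta_gE // zeta_sE.
Qed.
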